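(* Every ES-box and every GHZ-EPR box has communication value, in the direction $C\to AB$, at least equal to $1$: $\mathrm{CV}\ge 1$.
   Context: Three parties: Alice ($A$), Bob ($B$), Charlie ($C$). Notation: $|\Psi^+\rangle_{XY}=\frac1{\sqrt2}(|00\rangle+|11\rangle)$ (EPR pair of two qubits), $|GHZ\rangle_{ABC}=\frac1{\sqrt2}(|000\rangle+|111\rangle)$. A tripartite LOCC operation $\Lambda_{ABC}$ is a quantum channel (completely positive trace-preserving map) implemented by Alice, Bob and Charlie by rounds of local quantum operations and classical communication among them, with no pre-shared entanglement. Alice's and Bob's systems are qubits both at input and at output. An LOCC operation is called: - an ES-box (entanglement swapping) if Charlie's input system consists of two qubits $C=C_1C_2$ and the input $|\Psi^+\rangle_{AC_1}|\Psi^+\rangle_{BC_2}$ is mapped to the output $|\Psi^+\rangle_{AB}$; - a GHZ-EPR box if Charlie's input system is one qubit and the input $|GHZ\rangle_{ABC}$ is mapped to the output $|\Psi^+\rangle_{AB}$. For these boxes only the $AB$ output is considered: Charlie's output system is traced out. No requirement is made on the action of the box on other inputs. Communication value (CV) of a box, in the direction $C\to AB$: the maximal asymptotic rate (capacity), in classical bits per use of the box, at which the user Charlie can reliably (with error probability vanishing as the number $n$ of uses tends to infinity) send classical messages to the users Alice and Bob by means of $n$ uses of the box. Here Alice and Bob are regarded as a single party that may perform arbitrary joint quantum operations; the users may consume an arbitrary amount of pre-shared entanglement and use local ancillas, and may feed any (message-independent, shared) input state into the box, with Charlie applying message-dependent local operations on his systems; apart from the box there is no communication between Charlie and Alice–Bob.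 *)

(* Defs.v *)
From mathcomp Require Import all_boot all_order all_algebra.
From mathcomp Require Import complex.
From mathcomp Require Import all_classical all_reals all_analysis.

Set Implicit Arguments.
Unset Strict Implicit.
Unset Printing Implicit Defensive.

Import Order.TTheory GRing.Theory Num.Theory.
Import numFieldNormedType.Exports.

Local Open Scope ring_scope.
Local Open Scope complex_scope.
Local Open Scope sesquilinear_scope.

(* Products, powers and bool as finType structures, which keeps coercions out *)
(* of the dimensions #|I ** J|.                                               *)
Notation "I ** J" := (fintype.Datatypes_prod__canonical__fintype_Finite I J)
  (at level 40, left associativity).
Notation copies n I :=
  (finfun.finfun_finfun_of__canonical__fintype_Finite
     (fintype.fintype_ordinal__canonical__fintype_Finite n) I).
Notation qubit := (fintype.Datatypes_bool__canonical__fintype_Finite).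

(* The Hilbert space of a system is C^I, where the finite type I labels the   *)
(* computational basis; the system composed of I and J is labelled by I ** J, *)
(* and n copies of I by the functions from 'I_n to I. Operators and vectors   *)
(* are matrices whose rows and columns are indexed through [enum_rank].       *)

Definition ket_space (R : realType) (I : finType) : Type := 'cV[R[i]]_#|I|.

Definition op (R : realType) (I : finType) : Type := 'M[R[i]]_#|I|.

Definition superop (R : realType) (I J : finType) : Type :=
  'M[R[i]]_#|I| -> 'M[R[i]]_#|J|.

Section Operators.
Context {R : realType}.
Implicit Types I J K L : finType.

Definition entry I (X : op R I) (i j : I) : R[i] :=
  X (enum_rank i) (enum_rank j).

Definition mkop I (F : I -> I -> R[i]) : op R I :=
  \matrix_(a, b) F (enum_val a) (enum_val b).

Definition ket I (i : I) : ket_space R I := delta_mx (enum_rank i) 0.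

Definition unit_op I (i j : I) : op R I := delta_mx (enum_rank i) (enum_rank j).

Definition pure I (v : ket_space R I) : op R I := v *m v ^t*.

(* Over R[i], [0 <= z] entails that z is real, so that [psd X] makes X        *)
(* Hermitian.                                                                 *)
Definition psd I (X : op R I) : Prop :=
  forall v : ket_space R I, 0 <= (v ^t* *m X *m v) 0 0.

Definition density I (X : op R I) : Prop := psd X /\ \tr X = 1.

Definition tens_op I J (X : op R I) (Y : op R J) : op R (I ** J) :=
  mkop (fun p q => entry X p.1 q.1 * entry Y p.2 q.2).

Definition tens_op_n n I (X : 'I_n -> op R I) : op R (copies n I) :=
  mkop (fun f g : copies n I => \prod_(t < n) entry (X t) (f t) (g t)).

Definition ptrace2 I J (X : op R (I ** J)) : op R I :=
  mkop (fun i j => \sum_k entry X (i, k) (j, k)).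

(* Reordering of tensor factors, for a bijection h of the basis labels.       *)
Definition relabel I J (h : J -> I) (X : op R I) : op R J :=
  mkop (fun i j => entry X (h i) (h j)).

(* Tensor products of linear maps, given by their values on the matrix units  *)
(* |i,k><j,l| = |i><j| (x) |k><l|.                                            *)
Definition tens_map I J K L (Phi : superop R I J) (Psi : superop R K L) :
    superop R (I ** K) (J ** L) :=
  fun X => \sum_p \sum_q entry X p q *:
    tens_op (Phi (unit_op p.1 q.1)) (Psi (unit_op p.2 q.2)).

Definition tens_map_n n I J (Phi : superop R I J) :
    superop R (copies n I) (copies n J) :=
  fun X => \sum_(f : copies n I) \sum_(g : copies n I) entry X f g *:
    tens_op_n (fun t => Phi (unit_op (f t) (g t))).

Definition id_map I : superop R I I := fun X => X.

Definition completely_positive I J (Phi : superop R I J) : Prop :=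
  linear Phi /\
  forall (K : finType) (X : op R (I ** K)),
    psd X -> psd (tens_map Phi (@id_map K) X).

Definition channel I J (Phi : superop R I J) : Prop :=
  completely_positive Phi /\ forall X, \tr (Phi X) = \tr X.

(* The output system may depend on the outcome k.                             *)
Definition instrument K I (J : K -> finType) (E : forall k, superop R I (J k)) :
    Prop :=
  (forall k, completely_positive (E k)) /\
  forall X, \sum_k \tr (E k X) = \tr X.

Definition povm K I (D : K -> op R I) : Prop :=
  (forall k, psd (D k)) /\ \sum_k D k = 1%:M.

End Operators.

(* Finite-round tripartite LOCC maps, A B C being the current systems of the  *)
(* three parties and A' B' C' their output systems. In each round one party   *)
(* performs a local instrument and broadcasts the outcome k; the continuation *)
(* L k may depend on k, hence on all earlier outcomes. Summing over k means   *)
(* that the classical record is dropped once the protocol has ended.          *)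
Inductive locc (R : realType) (A' B' C' : finType) :
    forall A B C : finType,
      superop R (A ** B ** C) (A' ** B' ** C') -> Prop :=
| locc_stop (Lam : superop R (A' ** B' ** C') (A' ** B' ** C')) :
    (forall X, Lam X = X) -> locc Lam
| locc_Alice (A B C : finType)
    (Lam : superop R (A ** B ** C) (A' ** B' ** C'))
    (K : finType) (A1 : K -> finType) (E : forall k, superop R A (A1 k))
    (L : forall k, superop R (A1 k ** B ** C) (A' ** B' ** C')) :
    instrument E ->
    (forall k, locc (L k)) ->
    (forall X, Lam X = \sum_k
       L k (tens_map (tens_map (E k) (@id_map R B)) (@id_map R C) X)) ->
    locc Lam
| locc_Bob (A B C : finType)
    (Lam : superop R (A ** B ** C) (A' ** B' ** C'))
    (K : finType) (B1 : K -> finType) (E : forall k, superop R B (B1 k))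
    (L : forall k, superop R (A ** B1 k ** C) (A' ** B' ** C')) :
    instrument E ->
    (forall k, locc (L k)) ->
    (forall X, Lam X = \sum_k
       L k (tens_map (tens_map (@id_map R A) (E k)) (@id_map R C) X)) ->
    locc Lam
| locc_Charlie (A B C : finType)
    (Lam : superop R (A ** B ** C) (A' ** B' ** C'))
    (K : finType) (C1 : K -> finType) (E : forall k, superop R C (C1 k))
    (L : forall k, superop R (A ** B ** C1 k) (A' ** B' ** C')) :
    instrument E ->
    (forall k, locc (L k)) ->
    (forall X, Lam X = \sum_k
       L k (tens_map (@id_map R (A ** B)) (E k) X)) ->
    locc Lam.

Section Boxes.
Variable R : realType.

(* The basis states |0> and |1> of a qubit are labelled by false and true.    *)
Definition EPR : ket_space R (qubit ** qubit) :=
  (sqrtC 2)^-1 *: (ket (false, false) + ket (true, true)).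

Definition GHZ : ket_space R (qubit ** qubit ** qubit) :=
  (sqrtC 2)^-1 *: (ket (false, false, false) + ket (true, true, true)).

(* |Psi+>_{A C1} |Psi+>_{B C2}, with the factors reordered as A B (C1 C2).    *)
Definition ES_input : op R (qubit ** qubit ** (qubit ** qubit)) :=
  relabel
    (fun x : qubit ** qubit ** (qubit ** qubit) =>
       ((x.1.1, x.2.1), (x.1.2, x.2.2)))
    (tens_op (pure EPR) (pure EPR)).

Definition box_map (A B C A' B' C' : finType)
    (Lam : superop R (A ** B ** C) (A' ** B' ** C')) :
    superop R (A ** B ** C) (A' ** B') :=
  fun X => ptrace2 (Lam X).

Definition ES_box (C' : finType)
    (Lam : superop R (qubit ** qubit ** (qubit ** qubit))
                     (qubit ** qubit ** C')) : Prop :=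
  locc Lam /\ box_map Lam ES_input = pure EPR.

Definition GHZ_EPR_box (C' : finType)
    (Lam : superop R (qubit ** qubit ** qubit) (qubit ** qubit ** C')) :
    Prop :=
  locc Lam /\ box_map Lam (pure GHZ) = pure EPR.

Section CommunicationValue.
Variables A B C A' B' : finType.
Variable N : superop R (A ** B ** C) (A' ** B').

(* Factors: ancilla T and n copies of A B held by Alice-Bob, n copies of C.   *)
Definition box_inputs (T : finType) n :
    op R (T ** copies n (A ** B) ** copies n C) ->
    op R (T ** copies n (A ** B ** C)) :=
  relabel (fun x : T ** copies n (A ** B ** C) =>
    ((x.1, [ffun t => (x.2 t).1]), [ffun t => (x.2 t).2])).

(* n parallel uses of the box transmit one of M messages with error           *)
(* probability at most eps for each of them. The shared state rho, arbitrary  *)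
(* across the cut Alice-Bob : Charlie, comprises the pre-shared entanglement, *)
(* the ancilla T and the n box inputs of Alice-Bob, and the system S of       *)
(* Charlie, which E m turns into his n box inputs. Alice-Bob measure D.       *)
Definition has_code (n M : nat) (eps : R) : Prop :=
  exists (T S : finType)
    (rho : op R (T ** copies n (A ** B) ** S))
    (E : 'I_M -> superop R S (copies n C))
    (D : 'I_M -> op R (T ** copies n (A' ** B'))),
    [/\ density rho,
        forall m, channel (E m),
        povm D
      & forall m,
          let sent := box_inputs (tens_map (@id_map R _) (E m) rho) in
          let received := tens_map (@id_map R T) (tens_map_n (n := n) N) sent in
          (1 - eps)%:C <= \tr (D m *m received)].

Definition achievable_rate (r : R) : Prop :=
  exists (M : nat -> nat) (eps : nat -> R),
    [/\ forall n, has_code n (M n) (eps n),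
        (eps n @[n --> \oo] --> (0 : R))%classic
      & (r%:E <= limn_einf (fun n => (ln (M n)%:R / ln 2 / n%:R)%:E))%E].

Definition CV_C_to_AB : \bar R :=
  ereal_sup [set r%:E | r in achievable_rate]%classic.

End CommunicationValue.

End Boxes.

(* Main.v *)
(* Charlie encodes the bit k by applying Z^k to his qubit (to C1 for an       *)
(* ES-box). The equal mixture of the two resulting box inputs is separable    *)
(* across the cut A : BC, and LOCC maps send it to a state whose AB part is   *)
(* separable, hence of overlap at most 1/2 with the EPR pair. The unflipped   *)
(* input already contributes 1/2, so the flipped one is mapped to a state     *)
(* orthogonal to the EPR pair: each use of the box transmits one bit without  *)
(* error, even without pre-shared entanglement.                               *)

Require Import Defs.
From mathcomp Require Import all_boot all_order all_algebra.
From mathcomp Require Import complex ring.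
From mathcomp Require Import all_classical all_reals all_analysis.

Set Implicit Arguments.
Unset Strict Implicit.
Unset Printing Implicit Defensive.

Import Order.TTheory GRing.Theory Num.Theory.
Import numFieldNormedType.Exports.

Local Open Scope ring_scope.
Local Open Scope sesquilinear_scope.

(** * Operators and superoperators by their entries *)

(** Let X be the prescribed box input, Y the same input after Charlie's sign flip, N the box with
    Charlie's output traced out, and Psi the EPR projector. The functional W(Z) = tr Z - 2 tr(Psi
    Z), called [EPR_witness], is nonnegative on tensor products of two positive qubit operators;
    this comes from the 2 x 2 determinant inequality ([psd_qubit]) and AM-GM ([form2_pair]). Adding
    Y to X cancels the coherence between the two values of Charlie's flipped qubit, so X + Y is a
    sum of positive products across the cut A : BC. Each branch of an LOCC protocol sends such a
    product to a product ([locc_product]), whence W(N(X)) + W(N(Y)) >= 0.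

    Since N(X) = Psi, W(N(X)) = -1, while W(N(Y)) = 1 - 2 tr(Psi N(Y)). So tr(Psi N(Y)) <= 0, and
    the measurement {Psi, 1 - Psi} reads Charlie's bit with certainty ([CV_ge1_phase_flip]). Coding
    each use independently gives 2^n messages without error ([product_code]), which is rate 1
    ([capacity_ge1]). *)

Section Entries.
Context {R : realType}.
Implicit Types I J K L : finType.

Lemma entry_mkop I (F : I -> I -> R[i]) i j : entry (mkop F) i j = F i j.
Proof. by rewrite /entry mxE !enum_rankK. Qed.

Lemma op_ext I (X Y : op R I) : (forall i j, entry X i j = entry Y i j) -> X = Y.
Proof.
move=> eqXY; apply/matrixP => a b; rewrite -(enum_valK a) -(enum_valK b).
exact: eqXY.
Qed.

Lemma big_rank I (V : nmodType) (F : 'I_#|I| -> V) : \sum_a F a = \sum_i F (enum_rank i).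
Proof. by rewrite (reindex enum_rank) //; apply/onW_bij/enum_rank_bij. Qed.

Lemma entryD I (X Y : op R I) i j : entry (X + Y) i j = entry X i j + entry Y i j.
Proof. by rewrite /entry mxE. Qed.

Lemma entryZ I a (X : op R I) i j : entry (a *: X) i j = a * entry X i j.
Proof. by rewrite /entry mxE. Qed.

Lemma entry_sum I (T : finType) (P : pred T) (X : T -> op R I) i j :
  entry (\sum_(t | P t) X t) i j = \sum_(t | P t) entry (X t) i j.
Proof. by rewrite /entry summxE. Qed.

Lemma entry_unit I (k l i j : I) :
  entry (unit_op k l : op R I) i j = ((i == k) && (j == l))%:R.
Proof. by rewrite /entry mxE !(inj_eq enum_rank_inj). Qed.

Lemma entry1 I (i j : I) : entry (1%:M : op R I) i j = (i == j)%:R.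
Proof. by rewrite /entry mxE (inj_eq enum_rank_inj). Qed.

Lemma entryM I (X Y : op R I) i j :
  entry (X *m Y) i j = \sum_k entry X i k * entry Y k j.
Proof. by rewrite /entry mxE big_rank. Qed.

Lemma entry_adj I (X : op R I) i j : entry (X ^t*) i j = (entry X j i)^*.
Proof. by rewrite /entry !mxE. Qed.

Lemma entry_tens I J (X : op R I) (Y : op R J) p q :
  entry (tens_op X Y) p q = entry X p.1 q.1 * entry Y p.2 q.2.
Proof. exact: entry_mkop. Qed.

Lemma entry_tens_n n I (X : 'I_n -> op R I) (f g : copies n I) :
  entry (tens_op_n X) f g = \prod_(t < n) entry (X t) (f t) (g t).
Proof. exact: entry_mkop. Qed.

Lemma entry_relabel I J (h : J -> I) (X : op R I) i j :
  entry (relabel h X) i j = entry X (h i) (h j).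
Proof. exact: entry_mkop. Qed.

Lemma entry_ptrace2 I J (X : op R (I ** J)) i j :
  entry (ptrace2 X) i j = \sum_k entry X (i, k) (j, k).
Proof. exact: entry_mkop. Qed.

Lemma mxtraceE I (X : op R I) : \tr X = \sum_i entry X i i.
Proof. by rewrite /mxtrace big_rank. Qed.

Lemma sum_delta I (i : I) (F : I -> R[i]) : \sum_j (j == i)%:R * F j = F i.
Proof.
rewrite (bigD1 i) //= eqxx mul1r big1 ?addr0 // => j /negPf ->.
by rewrite mul0r.
Qed.

Lemma op_decomp I (X : op R I) :
  X = \sum_i \sum_j entry X i j *: (unit_op i j : op R I).
Proof.
apply: op_ext => k l; rewrite entry_sum -[LHS](sum_delta k (fun i => entry X i l)).
apply: eq_bigr => i _; rewrite entry_sum.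
rewrite -(sum_delta l (fun j => (i == k)%:R * entry X i j)).
apply: eq_bigr => j _; rewrite entryZ entry_unit (eq_sym k) (eq_sym l).
by case: eqP; case: eqP; rewrite /= ?(mul0r, mul1r, mulr0, mulr1).
Qed.

Lemma linear_zero I J (Phi : superop R I J) : linear Phi -> Phi 0 = 0.
Proof.
move=> linPhi; apply: (addIr (Phi 0)).
by rewrite add0r -{1}[Phi 0]scale1r -linPhi scale1r addr0.
Qed.

Lemma linear_scale I J (Phi : superop R I J) a (X : op R I) :
  linear Phi -> Phi (a *: X) = a *: Phi X.
Proof. by move=> linPhi; rewrite -[a *: X]addr0 linPhi linear_zero // addr0. Qed.

Lemma linear_add I J (Phi : superop R I J) (X Y : op R I) :
  linear Phi -> Phi (X + Y) = Phi X + Phi Y.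
Proof. by move=> linPhi; rewrite -[X in LHS]scale1r linPhi scale1r. Qed.

Lemma linear_bigsum I J (Phi : superop R I J) (T : finType) (X : T -> op R I) :
  linear Phi -> Phi (\sum_t X t) = \sum_t Phi (X t).
Proof.
move=> linPhi; apply: (big_morph Phi) => [Y Z|].
  exact: linear_add.
exact: linear_zero.
Qed.

Lemma linear_decomp I J (Phi : superop R I J) (X : op R I) : linear Phi ->
  Phi X = \sum_i \sum_j entry X i j *: Phi (unit_op i j).
Proof.
move=> linPhi; rewrite {1}(op_decomp X) linear_bigsum //.
apply: eq_bigr => i _; rewrite linear_bigsum //.
by apply: eq_bigr => j _; rewrite linear_scale.
Qed.

Lemma eq_linear_unit I J (Phi Psi : superop R I J) : linear Phi -> linear Psi ->
  (forall i j, Phi (unit_op i j) = Psi (unit_op i j)) -> Phi = Psi.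
Proof.
move=> linPhi linPsi eqU; apply: boolp.funext => X.
rewrite (linear_decomp X linPhi) (linear_decomp X linPsi).
by apply: eq_bigr => i _; apply: eq_bigr => j _; rewrite eqU.
Qed.

Lemma linear_id I : linear (@id_map R I).
Proof. by []. Qed.

Lemma linear_comp I J K (Psi : superop R J K) (Phi : superop R I J) :
  linear Psi -> linear Phi -> linear (Psi \o Phi).
Proof. by move=> linPsi linPhi a X Y; rewrite /= linPhi linPsi. Qed.

Lemma linear_ptrace2 I J : linear (@ptrace2 R I J).
Proof.
move=> a X Y; apply: op_ext => i j.
rewrite !(entryD, entryZ, entry_ptrace2) mulr_sumr -big_split /=.
by apply: eq_bigr => k _; rewrite entryD entryZ.
Qed.

Lemma entry_tens_map I J K L (Phi : superop R I J) (Psi : superop R K L) X p q :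
  entry (tens_map Phi Psi X) p q =
  \sum_a \sum_b entry X a b *
    (entry (Phi (unit_op a.1 b.1)) p.1 q.1 * entry (Psi (unit_op a.2 b.2)) p.2 q.2).
Proof.
rewrite /tens_map entry_sum; apply: eq_bigr => a _; rewrite entry_sum.
by apply: eq_bigr => b _; rewrite entryZ entry_tens.
Qed.

Lemma linear_tens_map I J K L (Phi : superop R I J) (Psi : superop R K L) :
  linear (tens_map Phi Psi).
Proof.
move=> a X Y; rewrite /tens_map scaler_sumr -big_split /=.
apply: eq_bigr => p _; rewrite scaler_sumr -big_split /=.
by apply: eq_bigr => q _; rewrite entryD entryZ scalerDl scalerA.
Qed.

Lemma unit_opE I J (p q : I ** J) :
  unit_op p q = tens_op (unit_op p.1 q.1) (unit_op p.2 q.2) :> op R (I ** J).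
Proof.
apply: op_ext => x y; rewrite entry_tens !entry_unit -!pair_eqE /pair_eq /=.
by rewrite -natrM mulnb andbACA.
Qed.

(** [tens_map] sees its factors only through matrix units; their linearity extends the product rule
    to all X and Y. *)
Lemma tens_map_tens I J K L (Phi : superop R I J) (Psi : superop R K L) X Y :
  linear Phi -> linear Psi ->
  tens_map Phi Psi (tens_op X Y) = tens_op (Phi X) (Psi Y).
Proof.
move=> linPhi linPsi; apply: op_ext => p q; rewrite entry_tens_map entry_tens.
rewrite (linear_decomp X linPhi) (linear_decomp Y linPsi) !entry_sum.
under [X in _ = X * _]eq_bigr do rewrite entry_sum.
under [X in _ = _ * X]eq_bigr do rewrite entry_sum.
rewrite big_distrlr /= [RHS]pair_bigA; apply: eq_bigr => a _ /=.
rewrite big_distrlr /= [RHS]pair_bigA; apply: eq_bigr => b _ /=.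
by rewrite !entryZ entry_tens mulrACA.
Qed.

Lemma tens_map_unit I J K L (Phi : superop R I J) (Psi : superop R K L) p q :
  linear Phi -> linear Psi ->
  tens_map Phi Psi (unit_op p q) =
  tens_op (Phi (unit_op p.1 q.1)) (Psi (unit_op p.2 q.2)).
Proof. by move=> linPhi linPsi; rewrite unit_opE tens_map_tens. Qed.

Lemma tens_map_id I J : tens_map (@id_map R I) (@id_map R J) = @id_map R (I ** J).
Proof.
apply: eq_linear_unit; [exact: linear_tens_map|exact: linear_id|] => p q.
by rewrite tens_map_unit /id_map; [rewrite -unit_opE| |].
Qed.

Lemma trace_tens I J (X : op R I) (Y : op R J) : \tr (tens_op X Y) = \tr X * \tr Y.
Proof.
rewrite !mxtraceE big_distrlr pair_bigA; apply: eq_bigr => p _.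
by rewrite entry_tens.
Qed.

Lemma trace_tens_map I J K L (Phi : superop R I J) (Psi : superop R K L) X :
  \tr (tens_map Phi Psi X) =
  \sum_p \sum_q entry X p q *
    (\tr (Phi (unit_op p.1 q.1)) * \tr (Psi (unit_op p.2 q.2))).
Proof.
rewrite raddf_sum; apply: eq_bigr => p _; rewrite raddf_sum.
by apply: eq_bigr => q _; rewrite /= mxtraceZ trace_tens.
Qed.

Lemma trace_decomp I J (X : op R (I ** J)) :
  \tr X = \sum_p \sum_q entry X p q *
    (\tr (unit_op p.1 q.1 : op R I) * \tr (unit_op p.2 q.2 : op R J)).
Proof. by have := trace_tens_map (@id_map R I) (@id_map R J) X; rewrite tens_map_id. Qed.

(** Serves a round of [locc]: only the sum over the outcomes of an instrument preserves the trace,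
    and the idle parties enter as the trace-preserving [Psi]. *)
Lemma trace_family_tensl (T : finType) I (J : T -> finType) K L
    (E : forall t, superop R I (J t)) (Psi : superop R K L) :
  (forall X, \sum_t \tr (E t X) = \tr X) -> (forall X, \tr (Psi X) = \tr X) ->
  forall X, \sum_t \tr (tens_map (E t) Psi X) = \tr X.
Proof.
move=> trE trPsi X; rewrite trace_decomp.
under eq_bigr do rewrite trace_tens_map.
rewrite exchange_big; apply: eq_bigr => p _; rewrite exchange_big.
apply: eq_bigr => q _; rewrite -mulr_sumr -mulr_suml trE.
by rewrite trPsi.
Qed.

Lemma trace_family_tensr (T : finType) I J K (L : T -> finType)
    (Phi : superop R I J) (E : forall t, superop R K (L t)) :
  (forall X, \tr (Phi X) = \tr X) -> (forall X, \sum_t \tr (E t X) = \tr X) ->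
  forall X, \sum_t \tr (tens_map Phi (E t) X) = \tr X.
Proof.
move=> trPhi trE X; rewrite trace_decomp.
under eq_bigr do rewrite trace_tens_map.
rewrite exchange_big; apply: eq_bigr => p _; rewrite exchange_big.
apply: eq_bigr => q _; rewrite -!mulr_sumr trE.
by rewrite trPhi.
Qed.

Lemma trace_ptrace2 I J (X : op R (I ** J)) : \tr (ptrace2 X) = \tr X.
Proof.
rewrite !mxtraceE; under eq_bigr do rewrite entry_ptrace2.
by rewrite pair_bigA; apply: eq_bigr => -[].
Qed.

Lemma trace_relabel I J (h : J -> I) (X : op R I) : bijective h ->
  \tr (relabel h X) = \tr X.
Proof.
move=> bij_h; rewrite !mxtraceE (reindex h) /=; last exact: onW_bij.
by apply: eq_bigr => j _; rewrite entry_relabel.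
Qed.

End Entries.

(** * Positive semidefinite operators and projectors *)

(** Polarization: the diagonal coefficients are the values at (1, 0) and (0, 1). Realness of the
    values at (1, 1) and (1, i) gives two equations whose difference is 2 conj(p) = 2 r. *)
Lemma psd_form2 (C : numClosedFieldType) (a b p r : C) :
  (forall x y, 0 <= x^* * a * x + x^* * p * y + (y^* * r * x + y^* * b * y)) ->
  [/\ 0 <= a, 0 <= b, r = p^* & `|p| ^+ 2 <= a * b].
Proof.
move=> quad.
have a0 : 0 <= a.
  by have := quad 1 0; rewrite !(rmorph1, rmorph0, mul1r, mulr1, mul0r, mulr0, addr0).
have b0 : 0 <= b.
  by have := quad 0 1; rewrite !(rmorph1, rmorph0, mul1r, mulr1, mul0r, mulr0, add0r).
have aR : a^* = a by apply/CrealP/ger0_real.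
have bR : b^* = b by apply/CrealP/ger0_real.
have rp : r = p^*.
  have eq1 : p^* + r^* = p + r.
    have /ger0_real/CrealP := quad 1 1.
    rewrite !(rmorph1, mul1r, mulr1) !rmorphD /= aR bR => eq1.
    have -> : p^* + r^* = a + p^* + (r^* + b) - (a + b) by ring.
    by rewrite eq1; ring.
  have eqi : r^* - p^* = p - r.
    have /ger0_real/CrealP := quad 1 'i.
    rewrite !(rmorph1, mul1r, mulr1, conjCi).
    rewrite !(rmorphD, rmorphM, rmorphN) /= !conjCi aR bR => eqi.
    apply: (mulfI (neq0Ci C)).
    have -> : 'i * (r^* - p^*) =
      a + p^* * - 'i + (- - 'i * r^* + - - 'i * b * - 'i) - (a - 'i * b * 'i) by ring.
    by rewrite eqi; ring.
  have two0 : (2 : C) != 0 by rewrite pnatr_eq0.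
  apply: (mulIf two0).
  have -> : p^* * 2 = (p^* + r^*) - (r^* - p^*) by ring.
  by rewrite eq1 eqi; ring.
split=> //; rewrite normCK -rp.
(* |p|^2 <= ab follows from the value of the form at (b, -r) if b > 0, at      *)
(* (-p, a) if a > 0, and at (1, -r) if a = b = 0.                             *)
have n0 : 0 <= p * r by rewrite rp mul_conjC_ge0.
have rR : r^* = p by rewrite rp conjCK.
have [b_gt0|] := boolP (0 < b).
  have := quad b (- r).
  have -> : b^* * a * b + b^* * p * - r + ((- r)^* * r * b + (- r)^* * b * - r) =
      b * (a * b - p * r) by rewrite rmorphN /= rR bR; ring.
  by rewrite pmulr_rge0 // subr_ge0.
rewrite lt0r b0 andbT negbK => /eqP b_eq0.
have [a_gt0|] := boolP (0 < a).
  have := quad (- p) a.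
  have -> : (- p)^* * a * - p + (- p)^* * p * a + (a^* * r * - p + a^* * b * a) =
      a * (a * b - p * r) by rewrite rmorphN /= -rp aR; ring.
  by rewrite pmulr_rge0 // subr_ge0.
rewrite lt0r a0 andbT negbK => /eqP a_eq0.
have := quad 1 (- r); rewrite rmorphN /= rR rmorph1 a_eq0 b_eq0.
have -> : 1 * 0 * 1 + 1 * p * - r + (- p * r * 1 + - p * 0 * - r) =
  - (p * r *+ 2) by ring.
by rewrite oppr_ge0 pmulrn_lle0 // mul0r.
Qed.

Section Positivity.
Context {R : realType}.
Implicit Types I J K L : finType.

Lemma psdP I (X : op R I) :
  psd X <-> forall v : I -> R[i], 0 <= \sum_i \sum_j (v i)^* * entry X i j * v j.
Proof.
have quadE (v : ket_space R I) : (v ^t* *m X *m v) 0 0 =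
    \sum_i \sum_j (v (enum_rank i) 0)^* * entry X i j * v (enum_rank j) 0.
  rewrite mxE big_rank exchange_big; apply: eq_bigr => j _.
  by rewrite mxE big_rank mulr_suml; apply: eq_bigr => i _; rewrite !mxE.
split=> [psdX v|psdX v]; last by rewrite quadE.
have := psdX (\col_a v (enum_val a)); rewrite quadE.
under eq_bigr do under eq_bigr do rewrite !mxE !enum_rankK.
by [].
Qed.

Lemma psdD I (X Y : op R I) : psd X -> psd Y -> psd (X + Y).
Proof.
by move=> psdX psdY v; rewrite mulmxDr mulmxDl mxE addr_ge0 ?psdX ?psdY.
Qed.

Lemma psd_sum I (T : finType) (X : T -> op R I) :
  (forall t, psd (X t)) -> psd (\sum_t X t).
Proof.
move=> psdX; elim/big_rec: _ => [v|t Y _ psdY]; last exact: psdD.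
by rewrite mulmx0 mul0mx mxE.
Qed.

(** The form of the relabelled operator at [v] is the form of [X] at the push-forward of [v] along
    [h]. As [h] is arbitrary, this covers diagonal blocks, hence partial traces. *)
Lemma psd_relabel I J (h : J -> I) (X : op R I) : psd X -> psd (relabel h X).
Proof.
move=> /psdP psdX; apply/psdP => v.
have := psdX (fun i => \sum_(j | h j == i) v j); congr (0 <= _).
rewrite [RHS](partition_big h predT) //=; apply: eq_bigr => i _.
rewrite [RHS]exchange_big [RHS](partition_big h predT) //=; apply: eq_bigr => i' _.
rewrite raddf_sum -mulrA mulr_suml [RHS]exchange_big; apply: eq_bigr => j /eqP hj.
rewrite !mulr_sumr; apply: eq_bigr => j' /eqP hj' /=.
by rewrite entry_relabel hj hj' mulrA.
Qed.

Lemma psd_ptrace2 I J (X : op R (I ** J)) : psd X -> psd (ptrace2 X).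
Proof.
move=> psdX.
suff -> : ptrace2 X = \sum_k relabel (fun i => (i, k)) X.
  by apply: psd_sum => k; apply: psd_relabel.
apply: op_ext => i j; rewrite entry_ptrace2 entry_sum.
by apply: eq_bigr => k _; rewrite entry_relabel.
Qed.

Lemma psd_gram I (Y : op R I) : psd (Y ^t* *m Y).
Proof.
move=> v.
have -> : v ^t* *m (Y ^t* *m Y) *m v = (Y *m v) ^t* *m (Y *m v).
  by rewrite trmx_mul map_mxM !mulmxA.
rewrite mxE sumr_ge0 // => a _; rewrite !mxE.
by rewrite mulrC mul_conjC_ge0.
Qed.

(** The states and measurements of the code are shown positive through these two equations, which
    pass entrywise to tensor products and powers, unlike the quadratic form. *)
Definition projector I (X : op R I) : Prop := X ^t* = X /\ X *m X = X.

Lemma projectorP I (X : op R I) : projector X <->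
  (forall i j, (entry X j i)^* = entry X i j) /\
  (forall i j, \sum_k entry X i k * entry X k j = entry X i j).
Proof.
split=> [[adjX idX]|[adjX idX]]; split.
- by move=> i j; rewrite -entry_adj adjX.
- by move=> i j; rewrite -entryM idX.
- by apply: op_ext => i j; rewrite entry_adj.
- by apply: op_ext => i j; rewrite entryM.
Qed.

Lemma projector_psd I (X : op R I) : projector X -> psd X.
Proof. by case=> adjX idX; rewrite -idX -{1}adjX; apply: psd_gram. Qed.

Lemma projector_compl I (X : op R I) : projector X -> projector (1%:M - X : op R I).
Proof.
case=> adjX idX; split.
  by rewrite linearB /= map_mxB trmx1 map_mx1 adjX.
by rewrite mulmxBl mul1mx mulmxBr mulmx1 idX subrr subr0.
Qed.

Lemma projector_unit I (i : I) : projector (unit_op i i : op R I).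
Proof.
split; last by rewrite mul_delta_mx.
by rewrite trmx_delta map_delta_mx.
Qed.

Lemma projector_tens I J (X : op R I) (Y : op R J) :
  projector X -> projector Y -> projector (tens_op X Y).
Proof.
move=> /projectorP[adjX idX] /projectorP[adjY idY]; apply/projectorP.
split=> p q; first by rewrite !entry_tens rmorphM /= adjX adjY.
rewrite entry_tens -idX -idY big_distrlr pair_bigA /=.
by apply: eq_bigr => r _; rewrite !entry_tens mulrACA.
Qed.

Lemma projector_tens_n n I (X : 'I_n -> op R I) :
  (forall t, projector (X t)) -> projector (tens_op_n X).
Proof.
move=> projX; apply/projectorP; split=> f g.
  rewrite !entry_tens_n rmorph_prod; apply: eq_bigr => t _.
  by have /projectorP[adjX _] := projX t; exact: adjX.
rewrite entry_tens_n.
have idX t : entry (X t) (f t) (g t) =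
    \sum_k entry (X t) (f t) k * entry (X t) k (g t).
  by have /projectorP[_ ->] := projX t.
rewrite (eq_bigr _ (fun t _ => idX t)) bigA_distr_bigA; apply: eq_bigr => h _.
by rewrite !entry_tens_n -big_split.
Qed.

Lemma projector_relabel I J (h : J -> I) (X : op R I) : bijective h ->
  projector X -> projector (relabel h X).
Proof.
move=> bij_h /projectorP[adjX idX]; apply/projectorP; split=> i j.
  by rewrite !entry_relabel adjX.
rewrite entry_relabel -idX (reindex h) /=; last exact: onW_bij.
by apply: eq_bigr => k _; rewrite !entry_relabel.
Qed.

Lemma psd_qubit (X : op R qubit) : psd X ->
  [/\ 0 <= entry X false false, 0 <= entry X true true,
      entry X true false = (entry X false true)^* &
      `|entry X false true| ^+ 2 <= entry X false false * entry X true true].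
Proof.
move=> /psdP psdX; apply: psd_form2 => x y.
have := psdX (fun c => if c then y else x).
by rewrite !big_bool /= addrC [X in X + _]addrC [X in _ + X]addrC.
Qed.

(** Complete positivity is stated with the ancilla on the right; the swap carries it over to an
    ancilla on the left. *)
Lemma tens_map_swap I J K L (Phi : superop R I J) (Psi : superop R K L) X :
  tens_map Phi Psi X =
  relabel (fun p : J ** L => (p.2, p.1))
    (tens_map Psi Phi (relabel (fun p : K ** I => (p.2, p.1)) X)).
Proof.
have bij_swap : bijective (fun p : K * I => (p.2, p.1)).
  by exists (fun p => (p.2, p.1)) => -[].
apply: op_ext => p q; rewrite entry_relabel !entry_tens_map.
rewrite (reindex (fun p : K ** I => (p.2, p.1))) /=; last exact: onW_bij.
apply: eq_bigr => a _.
rewrite (reindex (fun p : K ** I => (p.2, p.1))) /=; last exact: onW_bij.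
by apply: eq_bigr => b _; rewrite entry_relabel /= [X in _ * X]mulrC.
Qed.

(** Positivity is complete positivity with the one-dimensional ancilla [unit], which only decorates
    the labels. *)
Lemma cp_psd I J (Phi : superop R I J) X :
  completely_positive Phi -> psd X -> psd (Phi X).
Proof.
move=> [linPhi cpPhi] psdX.
have psdY := cpPhi unit (relabel fst X) (psd_relabel fst psdX).
have -> : Phi X =
    relabel (fun j => (j, tt)) (tens_map Phi (@id_map R unit) (relabel fst X)).
  have -> : relabel fst X = tens_op X (1%:M : op R unit).
    by apply: op_ext => -[i []] [j []]; rewrite entry_tens entry_relabel entry1 mulr1.
  rewrite tens_map_tens //; apply: op_ext => i j.
  by rewrite entry_relabel entry_tens entry1 mulr1.
exact: psd_relabel.
Qed.

Lemma cp_psd_tensr I J K (Phi : superop R I J) X :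
  completely_positive Phi -> psd X -> psd (tens_map (@id_map R K) Phi X).
Proof.
move=> [_ cpPhi] psdX; rewrite tens_map_swap.
by apply/psd_relabel/cpPhi/psd_relabel.
Qed.

End Positivity.

(** * LOCC maps on products across the cut A : BC *)

Section Locc.
Context {R : realType}.

(** [A ** B ** C] associates to the left, so a product across A : BC has to be regrouped. *)
Definition product_op (A B C : finType) (P : op R A) (Q : op R (B ** C)) :
    op R (A ** B ** C) :=
  relabel (fun x : A ** B ** C => (x.1.1, (x.1.2, x.2))) (tens_op P Q).

Lemma entry_product (A B C : finType) (P : op R A) (Q : op R (B ** C)) x y :
  entry (product_op P Q) x y =
  entry P x.1.1 y.1.1 * entry Q (x.1.2, x.2) (y.1.2, y.2).
Proof. by rewrite entry_relabel entry_tens. Qed.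

Lemma linear_product (A B C : finType) (P : op R A) :
  linear (@product_op A B C P : superop R _ _).
Proof.
move=> a X Y; apply: op_ext => x y.
by rewrite !(entryD, entryZ, entry_product) mulrDr mulrCA.
Qed.

(** For fixed [P] both sides are linear in [Q], so [Q] may be a matrix unit, which is itself a
    product across B : C. *)
Lemma tens_map_product (A A1 B B1 C C1 : finType) (E : superop R A A1)
    (F : superop R B B1) (G : superop R C C1) P Q :
  linear E -> linear F -> linear G ->
  tens_map (tens_map E F) G (product_op P Q) = product_op (E P) (tens_map F G Q).
Proof.
move=> linE linF linG.
have tens_productE (A2 B2 C2 : finType) (X : op R A2) (Y : op R B2) (Z : op R C2) :
    product_op X (tens_op Y Z) = tens_op (tens_op X Y) Z.
  by apply: op_ext => x y; rewrite entry_product !entry_tens mulrA.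
have linEF := linear_tens_map E F.
pose Phi := tens_map (tens_map E F) G \o product_op P : superop R (B ** C) _.
pose Psi := product_op (E P) \o tens_map F G : superop R (B ** C) _.
suff eqPhi : Phi = Psi by have := congr1 (fun T => T Q) eqPhi.
apply: eq_linear_unit => [||x y].
- by apply: linear_comp; [exact: linear_tens_map|exact: linear_product].
- by apply: linear_comp; [exact: linear_product|exact: linear_tens_map].
by rewrite /Phi /Psi /= unit_opE tens_productE !tens_map_tens // tens_productE.
Qed.

Section Protocol.
Variables A' B' C' : finType.

Lemma locc_linear (A B C : finType) (Lam : superop R (A ** B ** C) (A' ** B' ** C')) :
  locc Lam -> linear Lam.
Proof.
elim=> {A B C Lam} [Lam LamE|A B C Lam K A1 E L _ _ linL LamE
  |A B C Lam K B1 E L _ _ linL LamE|A B C Lam K C1 E L _ _ linL LamE] a X Y;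
  rewrite !LamE // scaler_sumr -big_split; apply: eq_bigr => k _ /=;
  by rewrite linear_tens_map linL.
Qed.

Lemma locc_trace (A B C : finType) (Lam : superop R (A ** B ** C) (A' ** B' ** C')) :
  locc Lam -> forall X, \tr (Lam X) = \tr X.
Proof.
elim=> {A B C Lam} [Lam LamE|A B C Lam K A1 E L [_ trE] _ trL LamE
  |A B C Lam K B1 E L [_ trE] _ trL LamE|A B C Lam K C1 E L [_ trE] _ trL LamE] X;
  rewrite LamE // raddf_sum; under eq_bigr do rewrite /= trL.
- by do 2!apply: trace_family_tensl => //.
- by apply: trace_family_tensl => //; apply: trace_family_tensr.
- exact: trace_family_tensr.
Qed.

(** Any such [S] contains the cone of sums of positive products across A : BC, so the lemma says
    that LOCC maps products into this cone. For each outcome, a round of Alice changes only [P], and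
    a round of Bob or Charlie changes only [Q], which may be entangled between them; the induction
    therefore stays with single products and sums over outcomes. *)
Lemma locc_product (S : op R (A' ** B' ** C') -> Prop) :
  S 0 -> (forall X Y, S X -> S Y -> S (X + Y)) ->
  (forall P Q, psd P -> psd Q -> S (product_op P Q)) ->
  forall (A B C : finType) (Lam : superop R (A ** B ** C) (A' ** B' ** C')),
  locc Lam -> forall P Q, psd P -> psd Q -> S (Lam (product_op P Q)).
Proof.
move=> S0 SD Sprod A B C Lam; elim=> {A B C Lam} [Lam LamE
  |A B C Lam K A1 E L [cpE _] _ SL LamE|A B C Lam K B1 E L [cpE _] _ SL LamE
  |A B C Lam K C1 E L [cpE _] _ SL LamE] P Q psdP psdQ; rewrite LamE;
  first exact: Sprod;
  apply: (big_ind S) => // k _; have [linE cp] := cpE k;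
  (* Charlie's round acts by one identity on [A ** B]; splitting it gives all three kinds of round
     the shape of [tens_map_product]. *)
  rewrite -?[@id_map R (A ** B)]tens_map_id tens_map_product //; apply: SL => //.
- exact: cp_psd.
- by rewrite tens_map_id.
- exact: cp.
- exact: cp_psd_tensr.
Qed.

End Protocol.

End Locc.

(** The left side is 2 Re(pq) <= 2 |pq|, and |pq|^2 <= (ad)(bc); AM-GM for ad and bc concludes, in
    squared form to avoid roots. *)
Lemma form2_pair (C : numClosedFieldType) (a b p c d q : C) :
  0 <= a -> 0 <= b -> 0 <= c -> 0 <= d ->
  `|p| ^+ 2 <= a * b -> `|q| ^+ 2 <= c * d ->
  p * q + p^* * q^* <= a * d + b * c.
Proof.
move=> a0 b0 c0 d0 pab qcd.
have ad0 : 0 <= a * d by apply: mulr_ge0.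
have bc0 : 0 <= b * c by apply: mulr_ge0.
have le_norm : p * q + p^* * q^* <= `|p * q| *+ 2.
  have -> : p * q + p^* * q^* = 'Re (p * q) *+ 2.
    by rewrite ReE rmorphM /= -mulr_natr mulfVK ?pnatr_eq0.
  by rewrite lerMn2r /= leif_Re_Creal.
apply: le_trans le_norm _.
rewrite -ler_sqr ?nnegrE ?addr_ge0 ?mulrn_wge0 //.
have pq4 : (`|p * q| *+ 2) ^+ 2 <= (a * d) * (b * c) *+ 4.
  rewrite normrM exprMn_n exprMn.
  have -> : a * d * (b * c) = (a * b) * (c * d) by ring.
  by rewrite lerMn2r /= ler_pM // exprn_ge0.
apply: le_trans pq4 _.
rewrite -subr_ge0.
have -> : (a * d + b * c) ^+ 2 - a * d * (b * c) *+ 4 = (a * d - b * c) ^+ 2 by ring.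
by rewrite real_exprn_even_ge0 // rpredB // ger0_real.
Qed.

(** * Zero-error codes from phase encodings *)

Section Codes.
Context {R : realType}.
Implicit Types I J K L : finType.

(** Conjugation by the diagonal matrix of [z], a unitary when all |z i| = 1. Its tensor product with
    an identity is again a phase map. *)
Definition phase_map I (z : I -> R[i]) : superop R I I :=
  fun X => mkop (fun i j => z i * entry X i j * (z j)^*).

Lemma entry_phase I (z : I -> R[i]) X i j :
  entry (phase_map z X) i j = z i * entry X i j * (z j)^*.
Proof. exact: entry_mkop. Qed.

Lemma linear_phase I (z : I -> R[i]) : linear (phase_map z).
Proof.
move=> a X Y; apply: op_ext => i j.
by rewrite !(entryD, entryZ, entry_phase); ring.
Qed.

Lemma psd_phase I (z : I -> R[i]) X : psd X -> psd (phase_map z X).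
Proof.
move=> /psdP psdX; apply/psdP => v.
have := psdX (fun i => (z i)^* * v i); congr (0 <= _).
apply: eq_bigr => i _; apply: eq_bigr => j _.
rewrite entry_phase rmorphM /= conjCK; ring.
Qed.

Lemma tens_map_phase K I (z : I -> R[i]) X :
  tens_map (@id_map R K) (phase_map z) X = phase_map (fun p => z p.2) X.
Proof.
suff -> : tens_map (@id_map R K) (phase_map z) = phase_map (fun p => z p.2) by [].
apply: eq_linear_unit => [||p q]; [exact: linear_tens_map|exact: linear_phase|].
rewrite tens_map_unit //; last exact: linear_phase.
rewrite [in RHS]unit_opE; apply: op_ext => x y.
rewrite entry_tens !entry_phase entry_tens /id_map; ring.
Qed.

Lemma tens_phase_map K I (z : I -> R[i]) X :
  tens_map (phase_map z) (@id_map R K) X = phase_map (fun p => z p.1) X.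
Proof.
rewrite tens_map_swap tens_map_phase; apply: op_ext => -[i k] [j l].
by rewrite !(entry_relabel, entry_phase).
Qed.

Lemma trace_phase I (z : I -> R[i]) X :
  (forall i, `|z i| = 1) -> \tr (phase_map z X) = \tr X.
Proof.
move=> z1; rewrite !mxtraceE; apply: eq_bigr => i _.
by rewrite entry_phase mulrAC -normCK z1 expr1n mul1r.
Qed.

Lemma channel_phase I (z : I -> R[i]) :
  (forall i, `|z i| = 1) -> channel (phase_map z).
Proof.
move=> z1; split=> [|X]; last exact: trace_phase.
split=> [|K X psdX]; first exact: linear_phase.
by rewrite tens_phase_map; apply: psd_phase.
Qed.

Lemma linear_tens_map_n n I J (Phi : superop R I J) :
  linear (tens_map_n (n := n) Phi).
Proof.
move=> a X Y; rewrite /tens_map_n scaler_sumr -big_split /=.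
apply: eq_bigr => f _; rewrite scaler_sumr -big_split /=.
by apply: eq_bigr => g _; rewrite entryD entryZ scalerDl scalerA.
Qed.

Lemma tens_map_n_tens n I J (Phi : superop R I J) (X : 'I_n -> op R I) :
  linear Phi -> tens_map_n Phi (tens_op_n X) = tens_op_n (fun t => Phi (X t)).
Proof.
move=> linPhi; apply: op_ext => u v; rewrite entry_sum entry_tens_n.
under [RHS]eq_bigr => t _.
  rewrite linear_decomp // entry_sum.
  under eq_bigr do rewrite entry_sum.
  over.
rewrite bigA_distr_bigA; apply: eq_bigr => f _; rewrite entry_sum bigA_distr_bigA.
apply: eq_bigr => g _; rewrite entryZ !entry_tens_n -big_split.
by apply: eq_bigr => t _; rewrite entryZ.
Qed.

Lemma trace_tens_n n I (X : 'I_n -> op R I) : \tr (tens_op_n X) = \prod_t \tr (X t).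
Proof.
rewrite mxtraceE; under [RHS]eq_bigr do rewrite mxtraceE.
by rewrite bigA_distr_bigA; apply: eq_bigr => f _; rewrite entry_tens_n.
Qed.

Lemma mul_tens_n n I (X Y : 'I_n -> op R I) :
  tens_op_n X *m tens_op_n Y = tens_op_n (fun t => X t *m Y t) :> op R (copies n I).
Proof.
apply: op_ext => f g; rewrite entryM entry_tens_n.
under [RHS]eq_bigr do rewrite entryM.
rewrite bigA_distr_bigA; apply: eq_bigr => h _.
by rewrite !entry_tens_n -big_split.
Qed.

(** Expanding a product of sums over all words; it makes the wordwise product measurement
    complete. *)
Lemma sum_tens_n n I K (D : K -> op R I) :
  \sum_(f : copies n K) tens_op_n (fun t => D (f t)) =
  tens_op_n (fun=> \sum_k D k) :> op R (copies n I).
Proof.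
apply: op_ext => u v; rewrite entry_sum entry_tens_n.
under [RHS]eq_bigr do rewrite entry_sum.
by rewrite bigA_distr_bigA; apply: eq_bigr => f _; rewrite entry_tens_n.
Qed.

Lemma tens_n1 n I : tens_op_n (fun=> 1%:M : op R I) = 1%:M :> op R (copies n I).
Proof.
apply: op_ext => f g; rewrite entry_tens_n entry1.
have [->|neq_fg] := eqVneq f g.
  by rewrite big1 // => t _; rewrite entry1 eqxx.
have [t /negPf ft] : exists t, f t != g t.
  apply/existsP; rewrite -negb_forall; apply: contra neq_fg => /forallP eq_fg.
  by apply/eqP/ffunP => t; apply/eqP.
by rewrite (bigD1 t) //= entry1 ft mul0r.
Qed.

Lemma mul_relabel I J (h : J -> I) (X Y : op R I) : bijective h ->
  relabel h X *m relabel h Y = relabel h (X *m Y : op R I) :> op R J.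
Proof.
move=> bij_h; apply: op_ext => i j; rewrite entryM entry_relabel entryM.
rewrite [RHS](reindex h) /=; last exact: onW_bij.
by apply: eq_bigr => k _; rewrite !entry_relabel.
Qed.

Lemma relabel_snd_tens I (X : op R I) :
  relabel snd X = tens_op (1%:M : op R unit) X.
Proof.
by apply: op_ext => -[[] i] [[] j]; rewrite entry_relabel entry_tens entry1 mul1r.
Qed.

(** A message is a word of length n over [K], and each letter is encoded and decoded in its own use
    of the box. By [decode] a single use is free of error, and success probabilities multiply. *)
Lemma product_code (A B C A' B' K : finType) (N : superop R (A ** B ** C) (A' ** B'))
    (s : K -> C -> R[i]) (X : op R (A ** B ** C)) (D : K -> op R (A' ** B')) n :
  linear N -> projector X -> \tr X = 1 ->
  (forall k c, `|s k c| = 1) ->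
  (forall k, projector (D k)) -> \sum_k D k = 1%:M ->
  (forall k, 1 <= \tr (D k *m N (phase_map (fun x => s k x.2) X))) ->
  has_code N n #|copies n K| 0.
Proof.
move=> linN projX trX s1 projD sumD decode.
have bij_snd I : bijective (snd : unit * I -> I).
  by exists (fun i => (tt, i)) => [[[]]|].
(* Alice-Bob keep no ancilla, and Charlie's share is exactly his n box inputs. The state is n copies
   of [X], regrouped. *)
exists unit, (copies n C).
exists (relabel (fun x : unit ** copies n (A ** B) ** copies n C =>
   [ffun t => (x.1.2 t, x.2 t)] : copies n (A ** B ** C)) (tens_op_n (fun=> X))).
exists (fun m => phase_map (fun g : copies n C =>
   \prod_t s ((enum_val m : copies n K) t) (g t))).
exists (fun m => relabel snd (tens_op_n (fun t => D ((enum_val m : copies n K) t)))).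
split=> [||| m].
- split; first by apply/psd_relabel/projector_psd/projector_tens_n.
  rewrite trace_relabel; first by rewrite trace_tens_n big1.
  exists (fun y : copies n (A ** B ** C) =>
      ((tt, [ffun t => (y t).1]), [ffun t => (y t).2])
    : unit ** copies n (A ** B) ** copies n C).
    by move=> [[[] f] g] /=; congr (_, _, _); apply/ffunP => t; rewrite !ffunE.
  by move=> y; apply/ffunP => t; rewrite !ffunE -surjective_pairing.
- by move=> m; apply: channel_phase => g; rewrite normr_prod big1.
- split=> [m|]; first by apply/psd_relabel/projector_psd/projector_tens_n.
  rewrite big_rank; under eq_bigr do rewrite enum_rankK relabel_snd_tens.
  apply: op_ext => -[[] f] [[] g]; rewrite entry_sum.
  under eq_bigr do rewrite entry_tens.
  by rewrite -mulr_sumr -entry_sum sum_tens_n sumD tens_n1 !entry1 mul1r.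
cbv zeta; set sent := box_inputs _; set received := tens_map _ _ sent.
(* Encoding by a product of phases leaves a product of single-use inputs, so the n boxes act factor
   by factor. *)
have -> : received = relabel snd (tens_op_n (fun t =>
    N (phase_map (fun x => s ((enum_val m : copies n K) t) x.2) X))).
  have -> : received = tens_map (@id_map R unit) (tens_map_n (n := n) N)
    (relabel snd (tens_op_n (fun t =>
       phase_map (fun x => s ((enum_val m : copies n K) t) x.2) X))).
    congr tens_map.
    rewrite /sent tens_map_phase; apply: op_ext => x y.
    rewrite !entry_relabel entry_phase entry_relabel !entry_tens_n.
    under [RHS]eq_bigr do rewrite entry_phase.
    rewrite !big_split /= rmorph_prod; congr (_ * _ * _);
      apply: eq_bigr => t _; rewrite !ffunE -?surjective_pairing //.
  rewrite relabel_snd_tens tens_map_tens //; last exact: linear_tens_map_n.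
  by rewrite tens_map_n_tens // relabel_snd_tens.
rewrite mul_relabel // trace_relabel // mul_tens_n trace_tens_n.
rewrite subr0.
(* The success probability is a product of factors that are each at least 1. *)
elim/big_ind: _ => // x y; apply: mulr_ege1.
Qed.

End Codes.

Lemma capacity_ge1 (R : realType) (A B C A' B' : finType)
    (N : superop R (A ** B ** C) (A' ** B')) :
  (forall n, has_code N n (2 ^ n) 0) -> (1 <= CV_C_to_AB N)%E.
Proof.
move=> code; apply: ereal_sup_ubound; exists 1 => //.
exists (fun n => 2 ^ n)%N, (fun=> 0); split=> //; first exact: cvg_cst.
have cvg1 : (((ln (2 ^ n)%:R / ln 2 / n%:R)%:E : \bar R) @[n --> \oo] --> 1%:E)%classic.
  (* The rate equals 1 only for n > 0; at n = 0 the division by zero yields 0. *)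
  apply: cvg_near_cst; near=> n.
  have n0 : (n%:R : R) != 0 by rewrite pnatr_eq0 -lt0n; near: n; exact: nbhs_infty_gt.
  have ln2 : ln (2 : R) != 0 by rewrite gt_eqF // ln_gt0 // ltr1n.
  by rewrite natrX lnXn ?ltr0n // -[ln 2 *+ n]mulr_natr mulrAC mulfK // divff.
by rewrite (cvg_limn_einf_sup cvg1).1.
Unshelve. all: by end_near.
Qed.

(** * The EPR witness and the two boxes *)

Section Boxes.
Context {R : realType}.

Lemma big_qubit2 (F : qubit ** qubit -> R[i]) : \sum_p F p =
  F (true, true) + F (true, false) + (F (false, true) + F (false, false)).
Proof.
have -> : \sum_p F p = \sum_x \sum_y F (x, y).
  by rewrite pair_bigA; apply: eq_bigr => -[].
by rewrite !big_bool.
Qed.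

Lemma entry_pure (I : finType) (v : ket_space R I) i j :
  entry (pure v) i j = v (enum_rank i) 0 * (v (enum_rank j) 0)^*.
Proof. by rewrite /entry /pure mxE big_ord1 !mxE. Qed.

Lemma ketE (I : finType) (i j : I) : ket i (enum_rank j) 0 = (j == i)%:R :> R[i].
Proof. by rewrite mxE andbT (inj_eq enum_rank_inj). Qed.

Lemma sqrtC2_conj : (sqrtC 2)^-1 * ((sqrtC 2)^-1)^* = 2^-1 :> R[i].
Proof.
by rewrite -normCK normfV exprVn ger0_norm ?sqrtC_ge0 ?ler0n // sqrtCK.
Qed.

Lemma entry_EPR p q :
  entry (pure (EPR R)) p q = 2^-1 * ((p.1 == p.2) && (q.1 == q.2))%:R.
Proof.
have EPRE (x : qubit ** qubit) :
    EPR R (enum_rank x) 0 = (sqrtC 2)^-1 * (x.1 == x.2)%:R.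
  rewrite mxE [X in _ * X]mxE !ketE; congr (_ * _).
  by case: x => [[] []]; rewrite /= ?addr0 ?add0r.
by rewrite entry_pure !EPRE rmorphM /= conjC_nat mulrACA sqrtC2_conj -natrM mulnb.
Qed.

Lemma entry_GHZ x y : entry (pure (GHZ R)) x y =
  2^-1 * ([&& x.1.1 == x.1.2, x.1.2 == x.2, y.1.1 == y.1.2 & y.1.2 == y.2])%:R.
Proof.
have GHZE (z : qubit ** qubit ** qubit) :
    GHZ R (enum_rank z) 0 = (sqrtC 2)^-1 * ((z.1.1 == z.1.2) && (z.1.2 == z.2))%:R.
  rewrite mxE [X in _ * X]mxE !ketE; congr (_ * _).
  by case: z => [[[] []] []]; rewrite /= ?addr0 ?add0r.
rewrite entry_pure !GHZE rmorphM /= conjC_nat mulrACA sqrtC2_conj -natrM mulnb.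
by rewrite -!andbA.
Qed.

(** Such an [X] projects onto the indicator vector of [b] divided by the square root of 2, a unit
    vector because [b] holds at two labels. EPR and GHZ are both of this kind. *)
Lemma projector_uniform (I : finType) (X : op R I) (b : pred I) :
  (forall i j, entry X i j = 2^-1 * (b i && b j)%:R) ->
  \sum_i (b i)%:R = 2 :> R[i] -> projector X /\ \tr X = 1.
Proof.
move=> XE sum_b; have two0 : (2 : R[i]) != 0 by rewrite pnatr_eq0.
split.
  apply/projectorP; split=> i j.
    by rewrite !XE rmorphM /= fmorphV /= !conjC_nat andbC.
  rewrite XE; under eq_bigr => k _.
    have -> : entry X i k * entry X k j = 2^-1 * 2^-1 * (b i && b j)%:R * (b k)%:R.
      by rewrite !XE; case: (b i); case: (b j); case: (b k) => /=; ring.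
    over.
  by rewrite -mulr_sumr sum_b mulrAC mulfVK.
rewrite mxtraceE; under eq_bigr do rewrite XE andbb.
by rewrite -mulr_sumr sum_b mulVf.
Qed.

Lemma projector_EPR : projector (pure (EPR R)) /\ \tr (pure (EPR R)) = 1.
Proof.
apply: (projector_uniform entry_EPR).
by rewrite -(pair_bigA _ (fun x y => ((x == y)%:R : R[i]))) !big_bool /= addr0 add0r.
Qed.

Lemma projector_GHZ : projector (pure (GHZ R)) /\ \tr (pure (GHZ R)) = 1.
Proof.
apply: (projector_uniform (b := fun x => (x.1.1 == x.1.2) && (x.1.2 == x.2))).
  by move=> x y; rewrite entry_GHZ -!andbA.
rewrite -(pair_bigA _ (fun z w => ((z.1 == z.2) && (z.2 == w))%:R : R[i])).
rewrite -(pair_bigA _ (fun x y => \sum_z ((x == y) && (y == z))%:R : R[i])).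
by rewrite !big_bool /= !(addr0, add0r).
Qed.

Lemma projector_ES : projector (ES_input R) /\ \tr (ES_input R) = 1.
Proof.
have [projE trE] := projector_EPR.
have bij : bijective (fun x : qubit ** qubit ** (qubit ** qubit) =>
    ((x.1.1, x.2.1), (x.1.2, x.2.2))).
  by exists (fun x => ((x.1.1, x.2.1), (x.1.2, x.2.2))) => -[[? ?] [? ?]].
split; first by apply: projector_relabel => //; apply: projector_tens.
by rewrite trace_relabel // trace_tens trE mulr1.
Qed.

Lemma trace_EPR_mul (Y : op R (qubit ** qubit)) :
  \tr (pure (EPR R) *m Y) =
  2^-1 * (entry Y (true, true) (true, true) + entry Y (false, false) (true, true) +
    (entry Y (true, true) (false, false) + entry Y (false, false) (false, false))).
Proof.
rewrite mxtraceE; under eq_bigr do rewrite entryM.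
under eq_bigr do under eq_bigr do rewrite entry_EPR.
rewrite !big_qubit2 /=; ring.
Qed.

(** Twice the standard entanglement witness 1/2 - Psi, evaluated at [Y]; it equals -1 on the EPR
    state. *)
Definition EPR_witness (Y : op R (qubit ** qubit)) : R[i] :=
  \tr Y - 2 * \tr (pure (EPR R) *m Y).

(** With diagonals (a, b), (c, d) and off-diagonal entries p, q, the witness is (a + b)(c + d) - (ac
    + bd + 2 Re(pq)) = ad + bc - 2 Re(pq). *)
Lemma EPR_witness_tens (P Q : op R qubit) : psd P -> psd Q ->
  0 <= EPR_witness (tens_op P Q).
Proof.
move=> /psd_qubit[a0 b0 rP leP] /psd_qubit[c0 d0 rQ leQ].
have two0 : (2 : R[i]) != 0 by rewrite pnatr_eq0.
rewrite /EPR_witness trace_EPR_mul mulVKf // trace_tens !mxtraceE !big_bool !entry_tens /=.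
have := form2_pair a0 b0 c0 d0 leP leQ; rewrite -subr_ge0; congr (0 <= _).
rewrite rP rQ; ring.
Qed.

Lemma EPR_witnessD X Y : EPR_witness (X + Y) = EPR_witness X + EPR_witness Y.
Proof. by rewrite /EPR_witness mulmxDr !mxtraceD; ring. Qed.

(** The conditions of [locc_product] hold for this witness because tracing out Charlie turns a
    product across A : BC into one across A : B. *)
Lemma locc_EPR_witness (C C' : finType)
    (Lam : superop R (qubit ** qubit ** C) (qubit ** qubit ** C')) P Q :
  locc Lam -> psd P -> psd Q -> 0 <= EPR_witness (box_map Lam (product_op P Q)).
Proof.
move=> loccL; move: P Q.
apply: (locc_product (S := fun X => 0 <= EPR_witness (ptrace2 X))) loccL => //.
- rewrite linear_zero; last exact: linear_ptrace2.
  by rewrite /EPR_witness mulmx0 mxtrace0 mulr0 subr0.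
- move=> X Y X0 Y0; rewrite linear_add; last exact: linear_ptrace2.
  by rewrite EPR_witnessD addr_ge0.
- move=> P Q psdP psdQ.
  suff -> : ptrace2 (product_op P Q) = tens_op P (ptrace2 Q).
    by apply: EPR_witness_tens => //; apply: psd_ptrace2.
  apply: op_ext => x y; rewrite entry_tens !entry_ptrace2 mulr_sumr.
  by apply: eq_bigr => k _; rewrite entry_product.
Qed.

(** [b] selects the basis states of Charlie whose sign is flipped, and [mixE] exhibits the
    unnormalized mixture of both inputs as separable across A : BC. *)
Lemma CV_ge1_phase_flip (C C' : finType)
    (Lam : superop R (qubit ** qubit ** C) (qubit ** qubit ** C'))
    (X : op R (qubit ** qubit ** C)) (b : pred C) (Q : qubit -> op R (qubit ** C)) :
  locc Lam -> box_map Lam X = pure (EPR R) -> projector X -> \tr X = 1 ->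
  (forall a, psd (Q a)) ->
  X + phase_map (fun x => (-1) ^+ b x.2) X =
    \sum_a product_op (unit_op a a : op R qubit) (Q a) ->
  (1 <= CV_C_to_AB (box_map Lam))%E.
Proof.
move=> loccL boxX projX trX psdQ mixE.
have [projE trE] := projector_EPR.
have linN : linear (box_map Lam).
  by apply: (linear_comp (@linear_ptrace2 _ _ _)); exact: locc_linear.
have norm_sign k (c : C) : `|(-1) ^+ (k && b c)| = 1 :> R[i].
  by rewrite normrX normrN1 expr1n.
set Y := phase_map _ X in mixE.
have trY : \tr (box_map Lam Y) = 1.
  rewrite trace_ptrace2 locc_trace // trace_phase //.
  by move=> x; exact: (norm_sign true).
have flipped : \tr (pure (EPR R) *m box_map Lam Y) <= 0.
  (* The unflipped input contributes 1 - 2 = -1, so the flipped one must contribute at least 1. *)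
  have : 0 <= EPR_witness (box_map Lam (X + Y)).
    rewrite mixE big_bool linear_add // EPR_witnessD addr_ge0 //;
      by apply: locc_EPR_witness => //; apply/projector_psd/projector_unit.
  rewrite linear_add // EPR_witnessD {1}/EPR_witness boxX projE.2 trE.
  rewrite /EPR_witness trY.
  have -> : 1 - 2 * 1 + (1 - 2 * \tr (pure (EPR R) *m box_map Lam Y)) =
    - (2 * \tr (pure (EPR R) *m box_map Lam Y)) by ring.
  by rewrite oppr_ge0 pmulr_rle0 ?ltr0n.
apply: capacity_ge1 => n.
have -> : (2 ^ n)%N = #|copies n qubit| by rewrite card_ffun card_bool card_ord.
(* Bit [false] sends [X] itself and is decoded by the EPR projector; bit [true] sends the flipped
   input and is decoded by the complement. *)
apply: (product_code (X := X) (s := fun k c => (-1) ^+ (k && b c))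
  (D := fun k => if k then 1%:M - pure (EPR R) else pure (EPR R))) => //.
- by case=> //; apply: projector_compl.
- by rewrite big_bool /=; exact: subrK.
case; last first.
  have -> : phase_map (fun x : qubit ** qubit ** C => (-1) ^+ (false && b x.2)) X = X.
    by apply: op_ext => x y; rewrite entry_phase /= rmorph1 mul1r mulr1.
  by rewrite boxX projE.2 trE.
by rewrite mulmxBl mul1mx raddfB /= trY lerBrDr gerDl.
Qed.

End Boxes.

Theorem theorem3 (R : realType) :
  (forall (C' : finType)
      (Lam : superop R (qubit ** qubit ** (qubit ** qubit))
                       (qubit ** qubit ** C')),
      ES_box Lam -> (1 <= CV_C_to_AB (box_map Lam))%E) /\
  (forall (C' : finType)
      (Lam : superop R (qubit ** qubit ** qubit) (qubit ** qubit ** C')),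
      GHZ_EPR_box Lam -> (1 <= CV_C_to_AB (box_map Lam))%E).
Proof.
have two0 : (2 : R[i]) != 0 by rewrite pnatr_eq0.
split=> C' Lam [loccL boxX].
- have [projX trX] := @projector_ES R.
  (* Flipping C1 dephases the pair A C1: for each [a] there remains |a><a| on A and on C1, with the
     pair B C2 intact. *)
  apply: (CV_ge1_phase_flip (b := fun c => c.1) (Q := fun a =>
      relabel (fun y : qubit ** (qubit ** qubit) => (y.2.1, (y.1, y.2.2)))
        (tens_op (unit_op a a : op R qubit) (pure (EPR R)))) loccL boxX) => //.
    move=> a; apply/psd_relabel/projector_psd/projector_tens.
      exact: projector_unit.
    by have [] := @projector_EPR R.
  apply: op_ext => -[[a1 b1] [c1 d1]] [[a2 b2] [c2 d2]].
  rewrite entryD entry_phase entry_relabel entry_tens entry_sum.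
  under [RHS]eq_bigr do rewrite entry_product entry_relabel entry_tens !entry_unit.
  (* The entry [e] of the untouched pair B C2 is a common factor, leaving a check over the labels of
     A and C1. *)
  rewrite big_bool /= rmorph_sign; set e := entry _ (b1, d1) _; rewrite entry_EPR.
  by case: a1 c1 a2 c2 => [] [] [] [] /=; field.
have [projX trX] := @projector_GHZ R.
(* Dephasing Charlie's qubit turns GHZ into the classical mixture of |000> and |111>. *)
apply: (CV_ge1_phase_flip (b := id) (Q := fun a => unit_op (a, a) (a, a))
  loccL boxX) => //.
  by move=> a; apply/projector_psd/projector_unit.
apply: op_ext => -[[a1 b1] c1] [[a2 b2] c2].
rewrite entryD entry_phase entry_GHZ entry_sum.
under [RHS]eq_bigr do rewrite entry_product !entry_unit.
rewrite big_bool /= rmorph_sign.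
by case: a1 b1 c1 a2 b2 c2 => [] [] [] [] [] [] /=; field.
Qed.
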